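(* Fix real numbers $\epsilon>0$ and $\lambda\ge 0$. Let $(\gamma,\varphi)$ be a bounded, finite-action solution of the system $$\begin{cases}\gamma''-\frac{2}{\epsilon}\varphi^2(1+2\gamma)-\frac{2}{r^2}(\gamma^2+\gamma)(1+2\gamma)=0 & \text{on }(0,1),\\ \varphi''+\frac{2\varphi'}{r}-\frac{2\varphi}{r^2}(1+2\gamma)^2-2\lambda\varphi(\varphi^2-1)=0 & \text{on }(0,1),\\ \gamma(1)=-\frac12,\quad \gamma(0)=0,\\ \varphi(1)=1\ \text{ (or }\varphi(1)=-1).\end{cases}$$ Then there exist constants $a_1$ and $b_2$ such that, near $r=0$, $$\varphi(r)=a_1r+O(r^3),\qquad \gamma(r)=b_2r^2+O(r^4),\qquad \gamma'(r)=2b_2r+O(r^3).$$ In particular, $\varphi(0)=\gamma'(0)=0$.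
   Context: Here $\gamma,\varphi$ are real-valued functions of $r\in(0,1)$, and primes denote $d/dr$. The boundary values at $r=0$ and $r=1$ (including those in the conclusion) are understood as limits. ''Bounded'' means $\gamma$ and $\varphi$ are bounded functions. ''Finite-action'' means $\mathcal{S}(\gamma,\varphi)<\infty$, where $$\mathcal{S}(\gamma,\varphi)=4\pi\int_0^1\Big[2\epsilon\Big(\gamma'^2+\frac{2}{r^2}(\gamma^2+\gamma)^2\Big)+r^2\varphi'^2+2\varphi^2(1+2\gamma)^2+\lambda r^2(\varphi^2-1)^2\Big]dr.$$ *)

(* Defs.v *)
From HB Require Import structures.
From mathcomp Require Import all_boot all_order ssralg ssrnum interval.
From mathcomp Require Import all_classical all_reals all_analysis.

Set Implicit Arguments.
Unset Strict Implicit.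
Unset Printing Implicit Defensive.

Import Order.TTheory GRing.Theory Num.Theory.
Import numFieldNormedType.Exports.

Local Open Scope ring_scope.
Local Open Scope classical_set_scope.

(* Functions on (0,1) are represented by total functions R -> R of which only
   the values on (0,1) matter: every notion below (pointwise derivatives,
   integral over (0,1), one-sided limits at 0 and 1) ignores the others. *)

Definition action_density (R : realType) (eps lambda : R) (gamma phi : R -> R)
    (r : R) : R :=
  2 * eps * (gamma^`() r ^+ 2
             + 2 / r ^+ 2 * (gamma r ^+ 2 + gamma r) ^+ 2)
  + r ^+ 2 * phi^`() r ^+ 2
  + 2 * phi r ^+ 2 * (1 + 2 * gamma r) ^+ 2
  + lambda * r ^+ 2 * (phi r ^+ 2 - 1) ^+ 2.

Definition action (R : realType) (eps lambda : R) (gamma phi : R -> R) :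
    \bar R :=
  ((4 * pi)%:E *
   \int[lebesgue_measure]_(r in `]0%R, 1%R[)
     (action_density eps lambda gamma phi r)%:E)%E.

Definition twice_derivable_at (R : realType) (f : R -> R) (r : R) : Prop :=
  derivable f r 1 /\ derivable f^`() r 1.

Definition gamma_equation (R : realType) (eps : R) (gamma phi : R -> R)
    (r : R) : Prop :=
  gamma^`(2) r - 2 / eps * phi r ^+ 2 * (1 + 2 * gamma r)
  - 2 / r ^+ 2 * (gamma r ^+ 2 + gamma r) * (1 + 2 * gamma r) = 0.

Definition phi_equation (R : realType) (lambda : R) (gamma phi : R -> R)
    (r : R) : Prop :=
  phi^`(2) r + 2 * phi^`() r / r
  - 2 * phi r / r ^+ 2 * (1 + 2 * gamma r) ^+ 2
  - 2 * lambda * phi r * (phi r ^+ 2 - 1) = 0.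

Definition boundary_conditions (R : realType) (gamma phi : R -> R) : Prop :=
  [/\ gamma r @[r --> 1^'-] --> - (1 / 2 : R),
      gamma r @[r --> 0^'+] --> (0 : R) &
      phi r @[r --> 1^'-] --> (1 : R) \/ phi r @[r --> 1^'-] --> (- 1 : R)].

Definition solves_system (R : realType) (eps lambda : R) (gamma phi : R -> R) :
    Prop :=
  (forall r : R, 0 < r < 1 ->
    [/\ twice_derivable_at gamma r, twice_derivable_at phi r,
        gamma_equation eps gamma phi r & phi_equation lambda gamma phi r])
  /\ boundary_conditions gamma phi.

(* Main.v *)
(* Both [gamma] and [Phi r = r * phi r] tend to 0 at 0 and solve an equation
   [y'' = 2 p y / r ^+ 2 + f] with [p] close to 1; the indicial exponents are
   2 and -1, and the vanishing at 0 excludes the second one. The maximum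
   principle with the barrier [C r] gives [gamma = O(r)], so that [p = 1 + O(r)]
   in both equations, and then the barrier [C (r ^+ 2 - K r ^+ 3)] gives
   [Phi = O(r ^+ 2)], hence [phi = O(r)], and finally [gamma = O(r ^+ 2)]. Now
   [y'' = 2 y / r ^+ 2 + O(r ^+ 2)] for both, that is
   [(r ^+ 4 (y / r ^+ 2)')' = O(r ^+ 4)], which is integrated twice. *)
Require Import Defs.
From HB Require Import structures.
From mathcomp Require Import all_boot all_order ssralg ssrnum interval.
From mathcomp Require Import all_classical all_reals all_analysis.
From mathcomp Require Import ring lra.

Set Implicit Arguments.
Unset Strict Implicit.

Import Order.TTheory GRing.Theory Num.Theory.
Import numFieldNormedType.Exports.

Local Open Scope ring_scope.
Local Open Scope classical_set_scope.

(** * Derivative rules and monotonicity on an interval *)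

Lemma is_derive1D (R : realType) (f g : R -> R) (x a b : R) :
  is_derive x 1 f a -> is_derive x 1 g b ->
  is_derive x 1 (fun t => f t + g t) (a + b).
Proof. by move=> df dg; exact: (is_deriveD df dg). Qed.

Lemma is_derive1B (R : realType) (f g : R -> R) (x a b : R) :
  is_derive x 1 f a -> is_derive x 1 g b ->
  is_derive x 1 (fun t => f t - g t) (a - b).
Proof. by move=> df dg; exact: (is_deriveB df dg). Qed.

Lemma is_derive1M (R : realType) (f g : R -> R) (x a b : R) :
  is_derive x 1 f a -> is_derive x 1 g b ->
  is_derive x 1 (fun t => f t * g t) (a * g x + f x * b).
Proof.
move=> df dg; apply: (is_derive_eq (is_deriveM df dg)).
by rewrite addrC mulrC.
Qed.

Lemma is_derive1Ml (R : realType) (c : R) (f : R -> R) (x a : R) :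
  is_derive x 1 f a -> is_derive x 1 (fun t => c * f t) (c * a).
Proof. by move=> df; exact: (is_deriveZ c df). Qed.

Lemma is_derive1Xn (R : realType) (n : nat) (x : R) :
  is_derive x 1 (fun t => t ^+ n) (n%:R * x ^+ n.-1).
Proof.
have -> : n%:R * x ^+ n.-1 = (n%:R * x ^+ n.-1) *: 1 by rewrite [RHS]mulr1.
have -> : (fun t : R => t ^+ n) = (id : R -> R) ^+ n by rewrite exprfctE.
exact: (is_deriveX n (is_derive_id x 1)).
Qed.

Lemma is_derive1V (R : realType) (f : R -> R) (x a : R) : f x != 0 ->
  is_derive x 1 f a -> is_derive x 1 (fun t => (f t)^-1) (- (f x ^- 2) * a).
Proof. by move=> fx0 df; exact: (is_deriveV fx0 df). Qed.

Lemma is_derive1_within_continuous (R : realType) (f f' : R -> R) (a b : R) :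
  (forall x, a <= x <= b -> is_derive x 1 f (f' x)) ->
  {within `[a, b], continuous f}.
Proof.
move=> df; apply: derivable_within_continuous => x.
by rewrite in_itv /= => /df [].
Qed.

Lemma is_derive1_ge0_le (R : realType) (f f' : R -> R) (a b : R) :
  (forall x, a <= x <= b -> is_derive x 1 f (f' x)) ->
  (forall x, a < x < b -> 0 <= f' x) -> a <= b -> f a <= f b.
Proof.
move=> df f'0; rewrite le_eqVlt => /predU1P[->//|ab].
have [x||c + e] := @MVT _ f f' a b ab.
- by rewrite in_itv /= => /andP[/ltW ax /ltW xb]; apply/df/andP.
- exact: is_derive1_within_continuous df.
rewrite in_itv /= => /f'0 c0.
by rewrite -subr_ge0 e mulr_ge0// subr_ge0 ltW.
Qed.

(** * Maximum principle on [(0, s]] *)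

(** At the interior maximum [f' c = 0]. If [d > 0], then [f'] would be positive just to the right of
    [c], and the mean value theorem would give [f (c + m) > f c]. *)
Lemma second_derivative_test (R : realType) (f f' : R -> R) (a b c d : R) :
  a < c < b -> (forall x, a <= x <= b -> is_derive x 1 f (f' x)) ->
  is_derive c 1 f' d -> (forall x, a <= x <= b -> f x <= f c) -> d <= 0.
Proof.
move=> /andP[ac cb] df df' fmax.
have fc0 : is_derive c 1 f 0.
  apply: (derive1_at_max (ltW (lt_trans ac cb))) => [t|//|t].
  - by rewrite in_itv /= => /andP[/ltW ta /ltW tb]; case: (df t) => //; apply/andP.
  - by rewrite in_itv /= ac.
  - by rewrite in_itv /= => /andP[/ltW ta /ltW tb]; apply/fmax/andP.
have f'c : f' c = 0.
  have fc : is_derive c 1 f (f' c) by apply: df; rewrite !ltW.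
  by case: fc => _ <-; case: fc0.
rewrite leNgt; apply/negP => d0.
case: df' => cv dv; move: cv; rewrite /derivable -/(derive f' c 1) => cv.
have {}cv : h^-1 *: (f' (h *: 1 + c) - f' c) @[h --> 0^'] --> d by rewrite -dv.
have [e /= e0 fe] := cvgr_gt _ cv _ d0.
pose m := Num.min (e / 2) (b - c).
have m0 : 0 < m by rewrite lt_min divr_gt0//= subr_gt0.
have me : m < e by rewrite gt_min ltr_pdivrMr// ltr_pMr ?ltr1n.
have mb : c + m <= b by rewrite -lerBrDl ge_min lexx orbT.
have [|x||x] := @MVT _ f f' c (c + m).
- by rewrite ltrDl.
- rewrite in_itv /= => /andP[cx xm]; apply: df.
  by rewrite (le_trans (ltW ac) (ltW cx)) (le_trans (ltW xm)).
- apply: is_derive1_within_continuous => x /andP[cx xm]; apply: df.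
  by rewrite (le_trans (ltW ac) cx) (le_trans xm).
rewrite in_itv /= => /andP[cx xm] fx.
have xc0 : 0 < x - c by rewrite subr_gt0.
have : 0 < f' x.
  have := fe (x - c); rewrite /= sub0r normrN gtr0_norm//.
  rewrite [_ *: 1]mulr1 subrK f'c subr0 => /(_ _ _).
  rewrite pmulr_rgt0 ?invr_gt0//; apply; last by rewrite gt_eqF.
  by rewrite ltrBlDl (lt_trans xm)// ltrD2l.
have : f (c + m) <= f c by apply: fmax; rewrite mb andbT (le_trans (ltW ac))// lerDl ltW.
by rewrite -subr_le0 fx addrAC subrr add0r pmulr_lle0// leNgt => /negP f'x /f'x.
Qed.

(** Naming both derivatives lets explicit barriers and unknown solutions be handled alike. The end
    [s] is included because comparison uses the value there. *)
Definition is_derive2 (R : realType) (s : R) (f f' f'' : R -> R) : Prop :=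
  forall x, 0 < x <= s -> is_derive x 1 f (f' x) /\ is_derive x 1 f' (f'' x).

(** If [y - B] were positive somewhere, it would have a positive interior maximum, where its second
    derivative is at least [P * (y - B) > 0]. The ends are excluded by the limit of [y] at 0, with
    [B >= 0], and by [y s <= B s]. *)
Lemma comparison_le (R : realType) (s : R) (y y' y'' B B' B'' P F : R -> R) :
  is_derive2 s y y' y'' -> is_derive2 s B B' B'' ->
  (forall x, 0 < x <= s ->
    [/\ 0 < P x, 0 <= B x, P x * y x - F x <= y'' x &
        B'' x <= P x * B x - F x]) ->
  y x @[x --> 0^'+] --> 0 -> y s <= B s ->
  forall x, 0 < x <= s -> y x <= B x.
Proof.
move=> dy dB yB y0 ys x /andP[x0 xs]; rewrite leNgt; apply/negP => yx.
have d0 : 0 < y x - B x by rewrite subr_gt0.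
(* As [B r1 >= 0], this choice makes [y - B] smaller at [r1] than at [x], so the maximum over
   [[r1, s]] is not at [r1]. *)
have [r1 [r10 r1x yr1]] : exists r1, [/\ 0 < r1, r1 < x & y r1 < y x - B x].
  near (0 : R)^'+ => r1; exists r1; split; near: r1.
  - exact: nbhs_right_gt.
  - exact: nbhs_right_lt.
  - exact: (cvgr_lt _ y0 _ d0).
have dw z : r1 <= z <= s -> is_derive z 1 (fun t => y t - B t) (y' z - B' z).
  move=> /andP[r1z zs]; have z0s : 0 < z <= s by rewrite (lt_le_trans r10).
  by apply: is_derive1B; [case: (dy _ z0s)|case: (dB _ z0s)].
have [c] := @EVT_max _ (fun t => y t - B t) r1 s (ltW (lt_le_trans r1x xs))
  (is_derive1_within_continuous dw).
rewrite in_itv /= => /andP[r1c cs] wmax.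
have wxc : y x - B x <= y c - B c by apply: wmax; rewrite in_itv /= xs ltW.
have c0s : 0 < c <= s by rewrite (lt_le_trans r10).
have [Pc Bc yc B''c] := yB c c0s.
have r1c' : r1 < c.
  rewrite lt_neqAle r1c andbT; apply/eqP => rc; move: wxc yr1; rewrite rc; lra.
have cs' : c < s.
  rewrite lt_neqAle cs andbT; apply/eqP => rc; move: wxc ys d0; rewrite rc; lra.
have r1cs : r1 < c < s by rewrite r1c'.
have w'c : is_derive c 1 (fun t => y' t - B' t) (y'' c - B'' c).
  by apply: is_derive1B; [case: (dy _ c0s)|case: (dB _ c0s)].
have : y'' c - B'' c <= 0.
  apply: (second_derivative_test r1cs dw w'c) => z zrs.
  by apply: wmax; rewrite in_itv.
apply/negP; rewrite -ltNge.
have : 0 < P c * (y c - B c) by rewrite mulr_gt0// (lt_le_trans d0).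
by lra.
Unshelve. all: by end_near. Qed.

Lemma is_derive2N (R : realType) (s : R) (f f' f'' : R -> R) :
  is_derive2 s f f' f'' -> is_derive2 s (fun x => - f x) (fun x => - f' x) (fun x => - f'' x).
Proof. by move=> df x /df[dx d2x]; split; exact: is_deriveN. Qed.

(** The one-sided comparison is applied to [y] and to [- y], with [F = |f|] serving both signs of
    the source. *)
Lemma comparison (R : realType) (s : R) (y y' y'' B B' B'' P f : R -> R) :
  is_derive2 s y y' y'' -> is_derive2 s B B' B'' ->
  (forall x, 0 < x <= s ->
    [/\ 0 < P x, 0 <= B x, y'' x = P x * y x + f x &
        B'' x <= P x * B x - `|f x|]) ->
  y x @[x --> 0^'+] --> 0 -> `|y s| <= B s ->
  forall x, 0 < x <= s -> `|y x| <= B x.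
Proof.
move=> dy dB yB y0 ys x xs; rewrite ler_norml; apply/andP; split; last first.
  apply: (comparison_le (P := P) (F := fun t => `|f t|) dy dB) => //.
  - move=> z /yB[Pz Bz -> B''z]; split => //.
    by have := ler_norm (- f z); rewrite normrN; lra.
  - exact: le_trans (ler_norm _) ys.
rewrite lerNl; apply: (comparison_le (P := P) (F := fun t => `|f t|)
  (is_derive2N dy) dB) => //.
- move=> z /yB[Pz Bz e B''z]; split => //.
  rewrite e mulrN.
  by have := ler_norm (f z); lra.
- by rewrite -[X in _ --> X]oppr0; exact: cvgN y0.
- by apply: le_trans ys; rewrite -normrN; exact: ler_norm.
Qed.

(** * Barrier bounds near the origin *)

(** The barrier [C * x] has zero second derivative, so it suffices that [2 * p * C / x >= F], which
    follows from [2 * p >= 1], [x <= 1] and [C >= F]. The summand [|y s| / s] of [C] takes care of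
    the end [s]. *)
Lemma linear_bound (R : realType) (s F : R) (y y' y'' p f : R -> R) :
  0 < s <= 1 -> is_derive2 s y y' y'' ->
  (forall x, 0 < x <= s -> [/\ y'' x = 2 * p x / x ^+ 2 * y x + f x,
    1 / 2 <= p x & `|f x| <= F]) ->
  y x @[x --> 0^'+] --> 0 ->
  exists2 C, 0 <= C & forall x, 0 < x <= s -> `|y x| <= C * x.
Proof.
move=> /andP[s0 s1] dy yE y0.
have F0 : 0 <= F.
  by have [|_ _] := yE s; [rewrite s0/=|exact: le_trans].
pose C := F + `|y s| / s.
have C0 : 0 <= C by rewrite addr_ge0// divr_ge0// ltW.
exists C => //.
apply: (comparison (B' := fun=> C * (1%:R * 1)) (B'' := fun=> 0)
  (P := fun x => 2 * p x / x ^+ 2) (f := f) dy) => //.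
- move=> x _; split; last exact: is_derive_cst.
  by apply: is_derive1Ml; exact: (is_derive1Xn 1 x).
- move=> x x0s; have [e px fx] := yE x x0s; have /andP[x0 xs] := x0s.
  split=> //; [| by rewrite mulr_ge0// ltW|].
    by rewrite divr_gt0 ?exprn_gt0//; lra.
  rewrite subr_ge0 (le_trans fx)//.
  have -> : 2 * p x / x ^+ 2 * (C * x) = 2 * p x * C / x by field; rewrite gt_eqF.
  rewrite ler_pdivlMr//.
  have FC : F <= C by rewrite lerDl divr_ge0// ltW.
  have Cp : 0 <= (2 * p x - 1) * C by rewrite mulr_ge0//; lra.
  have Fx : F * x <= F by rewrite ler_piMr// (le_trans xs).
  lra.
- by rewrite mulrDl divfK ?gt_eqF// lerDr mulr_ge0// ltW.
Qed.

(* The barrier [C * (x ^+ 2 - K * x ^+ 3)]: its cubic correction absorbs the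
   defect [1 - p], which alone would produce a logarithm. *)
Lemma quadratic_bound (R : realType) (s K F : R) (y y' y'' p f : R -> R) :
  0 < s -> 1 <= K -> K * s <= 1 / 2 -> is_derive2 s y y' y'' ->
  (forall x, 0 < x <= s -> [/\ y'' x = 2 * p x / x ^+ 2 * y x + f x,
    1 - K * x <= p x & `|f x| <= F * x]) ->
  y x @[x --> 0^'+] --> 0 ->
  exists2 C, 0 <= C & forall x, 0 < x <= s -> `|y x| <= C * x ^+ 2.
Proof.
move=> s0 K1 Ks dy yE y0.
have F0 : 0 <= F.
  have [|_ _] := yE s; first by rewrite s0/=.
  by move=> /(le_trans (normr_ge0 _)); rewrite pmulr_lge0.
(* [F] absorbs the source. Since [K * s <= 1 / 2], the barrier at [s] is at least [C * s ^+ 2 / 2],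
   whence the factor 2. *)
pose C := F + 2 * (`|y s| / s ^+ 2).
have ys0 : 0 <= `|y s| / s ^+ 2 by rewrite divr_ge0// exprn_ge0// ltW.
have C0 : 0 <= C by rewrite addr_ge0// mulr_ge0.
have Kx x : 0 < x <= s -> K * x <= 1 / 2.
  by move=> /andP[_ xs]; rewrite (le_trans _ Ks)// ler_pM2l//; lra.
have yB : forall x, 0 < x <= s -> `|y x| <= C * (x ^+ 2 - K * x ^+ 3).
  apply: (comparison (B' := fun x => C * (2%:R * x ^+ 1 - K * (3%:R * x ^+ 2)))
    (B'' := fun x => C * (2%:R * (1%:R * x ^+ 0) - K * (3%:R * (2%:R * x ^+ 1))))
    (P := fun x => 2 * p x / x ^+ 2) (f := f) dy) => //.
  - move=> x _; split; apply: is_derive1Ml; apply: is_derive1B.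
    + exact: is_derive1Xn.
    + by apply: is_derive1Ml; exact: is_derive1Xn.
    + by apply: is_derive1Ml; exact: is_derive1Xn.
    + by do 2 apply: is_derive1Ml; exact: is_derive1Xn.
  - move=> x x0s; have [e px fx] := yE x x0s; have /andP[x0 xs] := x0s.
    have Kx0 := Kx x x0s.
    split=> //.
    + by rewrite divr_gt0 ?exprn_gt0//; lra.
    + have -> : x ^+ 2 - K * x ^+ 3 = x ^+ 2 * (1 - K * x) by ring.
      rewrite mulr_ge0// mulr_ge0 ?exprn_ge0 ?(ltW x0)//.
      by lra.
    have -> : 2 * p x / x ^+ 2 * (C * (x ^+ 2 - K * x ^+ 3)) =
              2 * p x * (C * (1 - K * x)) by field; rewrite gt_eqF.
    (* With [P] the coefficient of [y] and [B] the barrier, [P * B >= 2 * C * (1 - K * x) ^+ 2]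
       while [B'' = C * (2 - 6 * K * x)]. The difference is at least [2 * C * K * x], hence at least
       [F * x] because [K >= 1]. *)
    have CK : 0 <= C * (1 - K * x) by rewrite mulr_ge0//; lra.
    have Cp : 0 <= (p x - (1 - K * x)) * (C * (1 - K * x)).
      by rewrite mulr_ge0//; lra.
    have FC : F * x <= C * x.
      by rewrite ler_pM2r// /C; lra.
    have CxK : 0 <= C * x * (K - 1) by rewrite !mulr_ge0 ?(ltW x0)//; lra.
    have CxKK : 0 <= C * (K * x) ^+ 2 by rewrite mulr_ge0// sqr_ge0.
    have Cx : 0 <= C * x by rewrite mulr_ge0// ltW.
    by lra.
  - have -> : s ^+ 2 - K * s ^+ 3 = s ^+ 2 * (1 - K * s) by ring.
    have yE1 : `|y s| = `|y s| / s ^+ 2 * s ^+ 2.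
      by rewrite divfK// gt_eqF// exprn_gt0.
    have : 0 <= s ^+ 2 * (C * (1 - K * s) - `|y s| / s ^+ 2).
      rewrite mulr_ge0 ?exprn_ge0 ?(ltW s0)//.
      have : 0 <= C * (1 / 2 - K * s) by rewrite mulr_ge0// subr_ge0.
      by rewrite /C; lra.
    by rewrite [X in _ -> X <= _]yE1; lra.
exists C => // x x0s; rewrite (le_trans (yB x x0s))// ler_wpM2l//.
have /andP[x0 _] := x0s; rewrite gerBl mulr_ge0 ?exprn_ge0 ?ltW//; lra.
Qed.

(** * Second-order expansion at the origin *)

(* [x ^+ 4 * (y x / x ^+ 2)^`()] is [x ^+ 2 * y' x - 2 * x * y x], and the
   derivative of the latter is [x ^+ 2 * h x]. Were it positive in the limit,
   [y x / x ^+ 2] would be unbounded. *)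
Lemma wronskian_le (R : realType) (s H C : R) (y y' y'' h : R -> R) :
  s <= 1 -> is_derive2 s y y' y'' ->
  (forall x, 0 < x <= s -> [/\ y'' x = 2 / x ^+ 2 * y x + h x,
    `|h x| <= H * x ^+ 2 & `|y x| <= C * x ^+ 2]) ->
  forall x, 0 < x <= s -> x ^+ 2 * y' x - 2 * (x * y x) <= H * x ^+ 5.
Proof.
move=> s1 dy yE x x0s; have /andP[x0 xs] := x0s; rewrite leNgt; apply/negP.
pose z t := t ^+ 2 * y' t - 2 * (t * y t).
rewrite -subr_gt0 -/(z x); set d := z x - _ => d0.
have H0 : 0 <= H.
  have [_ + _] := yE x x0s.
  by move=> /(le_trans (normr_ge0 _)); rewrite pmulr_lge0// exprn_gt0.
(* [H * t ^+ 5 - z t] is nondecreasing, its derivative being [5 * H * t ^+ 4 - t ^+ 2 * h t]; so a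
   positive excess [d] at [x] persists down to 0. *)
have zd r : 0 < r <= x -> d <= z r.
  move=> /andP[r0 rx].
  have : H * r ^+ 5 - z r <= H * x ^+ 5 - z x.
    pose z' t := (2%:R * t ^+ 1) * y' t + t ^+ 2 * y'' t
                 - 2 * (1 * y t + t * y' t).
    apply: (@is_derive1_ge0_le _ (fun t => H * t ^+ 5 - z t)
      (fun t => H * (5%:R * t ^+ 4) - z' t)) => // t /andP[rt tx].
      have [|d1 d2] := dy t; first by rewrite (lt_le_trans r0)// (le_trans tx).
      apply: is_derive1B; first by apply: is_derive1Ml; exact: is_derive1Xn.
      apply: is_derive1B; first by apply: is_derive1M => //; exact: is_derive1Xn.
      by apply: is_derive1Ml; apply: is_derive1M => //; exact: is_derive_id.
    have t0 : 0 < t by exact: lt_trans rt.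
    have [|e ht _] := yE t; first by rewrite t0 (le_trans (ltW tx)).
    have -> : z' t = t ^+ 2 * h t by rewrite /z' e; field; rewrite gt_eqF.
    have : 0 <= t ^+ 2 * (H * t ^+ 2 - h t).
      by rewrite mulr_ge0 ?exprn_ge0 ?(ltW t0)// subr_ge0 (le_trans (ler_norm _)).
    have : 0 <= H * t ^+ 4 by rewrite mulr_ge0// exprn_ge0// ltW.
    by lra.
  have : 0 <= H * r ^+ 5 by rewrite mulr_ge0// exprn_ge0// ltW.
  by rewrite /d; lra.
have C0 : 0 <= C.
  have [_ _] := yE x x0s.
  by move=> /(le_trans (normr_ge0 _)); rewrite pmulr_lge0// exprn_gt0.
(* [y / t ^+ 2 + d / t] will be nondecreasing on [(0, x]]. Comparing [r = d / N] with [x] yields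
   [N - C <= C + d / x], which this [N] violates; [N >= d / x] ensures [r <= x]. *)
pose N := 2 * C + d / x + 1.
have dx0 : 0 < d / x by rewrite divr_gt0.
have N0 : 0 < N by rewrite /N; lra.
pose r := d / N.
have r0 : 0 < r by rewrite divr_gt0.
have rx : r <= x.
  rewrite ler_pdivrMr// mulrC -ler_pdivrMr//.
  by rewrite /N; lra.
have yb t : 0 < t <= x -> `|y t * (t ^+ 2)^-1| <= C.
  move=> /andP[t0 tx]; have [|_ _ yt] := yE t; first by rewrite t0 (le_trans tx).
  by rewrite normrM [X in _ * X]gtr0_norm ?invr_gt0 ?exprn_gt0// ler_pdivrMr ?exprn_gt0.
have : y r * (r ^+ 2)^-1 + d * r^-1 <= y x * (x ^+ 2)^-1 + d * x^-1.
  apply: (@is_derive1_ge0_le _ (fun t => y t * (t ^+ 2)^-1 + d * t^-1)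
    (fun t => (y' t * (t ^+ 2)^-1 + y t * (- (t ^+ 2) ^- 2 * (2%:R * t ^+ 1)))
              + d * (- t ^- 2 * 1))) => // t /andP[rt tx].
    have t0 : 0 < t by exact: lt_le_trans rt.
    have [|d1 d2] := dy t; first by rewrite t0 (le_trans tx).
    apply: is_derive1D.
      apply: is_derive1M => //; apply: is_derive1V; last exact: is_derive1Xn.
      by rewrite gt_eqF// exprn_gt0.
    by apply: is_derive1Ml; apply: (@is_derive1V _ id); rewrite ?gt_eqF//.
  have t0 : 0 < t by exact: lt_trans rt.
  have -> : y' t / t ^+ 2 + y t * (- (t ^+ 2) ^- 2 * (2 * t ^+ 1)) +
            d * (- t ^- 2 * 1) = (z t - d * t ^+ 2) / t ^+ 4.
    by rewrite /z; field; rewrite gt_eqF.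
  rewrite divr_ge0 ?exprn_ge0 ?(ltW t0)// subr_ge0.
  apply: (@le_trans _ _ d); last by apply: zd; rewrite t0 ltW.
  by rewrite ler_piMr ?(ltW d0)// exprn_ile1 ?(ltW t0)// (le_trans (ltW tx))// (le_trans xs).
have -> : d * r^-1 = N by rewrite /r; field; rewrite !gt_eqF.
have := yb r; rewrite r0 rx => /(_ isT); rewrite ler_norml => /andP[+ _].
have := yb x; rewrite x0 lexx => /(_ isT); rewrite ler_norml => /andP[_ +].
by rewrite /N; lra.
Qed.

(** Applying [wronskian_le] to [y] and [- y] bounds the derivative of [eta = y / x ^+ 2] by [H * x].
    Thus [eta] has a limit [b] at 0, approached at rate [H * x ^+ 2], and both estimates follow from
    [y = x ^+ 2 * eta]. *)
Lemma quadratic_expansion (R : realType) (s H C : R) (y y' y'' h : R -> R) :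
  0 < s <= 1 -> is_derive2 s y y' y'' ->
  (forall x, 0 < x <= s -> [/\ y'' x = 2 / x ^+ 2 * y x + h x,
    `|h x| <= H * x ^+ 2 & `|y x| <= C * x ^+ 2]) ->
  exists b, forall x, 0 < x <= s ->
    `|y x - b * x ^+ 2| <= H * x ^+ 4 /\ `|y' x - 2 * b * x| <= 3 * H * x ^+ 3.
Proof.
move=> /andP[s0 s1] dy yE.
have H0 : 0 <= H.
  have [|_ + _] := yE s; first by rewrite s0/=.
  by move=> /(le_trans (normr_ge0 _)); rewrite pmulr_lge0// exprn_gt0.
have zH x : 0 < x <= s -> `|x ^+ 2 * y' x - 2 * (x * y x)| <= H * x ^+ 5.
  move=> x0s; rewrite ler_norml (wronskian_le s1 dy yE x0s) andbT.
  have := @wronskian_le _ s H C _ _ _ (fun t => - h t) s1 (is_derive2N dy) _ x x0s.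
  rewrite lerNl; move=> /(_ _)/wrap[t t0s|]; last by lra.
  have [e ht yt] := yE t t0s; rewrite !normrN; split => //.
  by rewrite e opprD mulrN.
pose eta t := y t * (t ^+ 2)^-1.
pose eta' t := y' t * (t ^+ 2)^-1 + y t * (- (t ^+ 2) ^- 2 * (2%:R * t ^+ 1)).
have deta x : 0 < x <= s -> is_derive x 1 eta (eta' x).
  move=> x0s; have /andP[x0 xs] := x0s.
  apply: is_derive1M; first by case: (dy x x0s).
  by apply: is_derive1V; [rewrite gt_eqF// exprn_gt0|exact: is_derive1Xn].
have eta'H x : 0 < x <= s -> `|eta' x| <= H * x.
  move=> x0s; have /andP[x0 xs] := x0s.
  have -> : eta' x = (x ^+ 2 * y' x - 2 * (x * y x)) / x ^+ 4.
    by rewrite /eta'; field; rewrite gt_eqF.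
  have x40 : 0 < x ^+ 4 by rewrite exprn_gt0.
  rewrite normrM [X in _ * X]gtr0_norm ?invr_gt0// ler_pdivrMr//.
  have -> : H * x * x ^+ 4 = H * x ^+ 5 by ring.
  exact: zH.
(* The bound on [eta'] makes [g 1] nondecreasing and [g (-1)] nonincreasing; they enclose [eta]. *)
pose g (e : R) t := eta t + e * (H * t ^+ 2).
have dg e x : 0 < x <= s -> is_derive x 1 (g e) (eta' x + e * (H * (2%:R * x ^+ 1))).
  move=> x0s; apply: is_derive1D; first exact: deta.
  by do 2 apply: is_derive1Ml; exact: is_derive1Xn.
have gincr x t : 0 < x -> x <= t -> t <= s -> g 1 x <= g 1 t /\ - g (-1) x <= - g (-1) t.
  move=> x0 xt ts; split.
    apply: (is_derive1_ge0_le _ _ xt) => [r /andP[xr rt]|r /andP[xr rt]].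
      by apply: dg; rewrite (lt_le_trans x0)// (le_trans rt).
    have r0s : 0 < r <= s by rewrite (lt_trans x0)// (le_trans (ltW rt)).
    have := eta'H r r0s; rewrite ler_norml => /andP[+ _].
    have : 0 <= H * r by rewrite mulr_ge0// ltW// (lt_trans x0).
    by lra.
  apply: (@is_derive1_ge0_le _ (fun t => - g (-1) t) _ _ _ _ _ xt)
    => [r /andP[xr rt]|r /andP[xr rt]].
    apply: is_deriveN.
    by apply: dg; rewrite (lt_le_trans x0)// (le_trans rt).
  have r0s : 0 < r <= s by rewrite (lt_trans x0)// (le_trans (ltW rt)).
  have := eta'H r r0s; rewrite ler_norml => /andP[_].
  have : 0 <= H * r by rewrite mulr_ge0// ltW// (lt_trans x0).
  by lra.
have gle x t : 0 < x <= s -> 0 < t <= s -> g (-1) x <= g 1 t.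
  move=> x0s t0s; have /andP[x0 xs] := x0s; have /andP[t0 ts] := t0s.
  have Hx : 0 <= H * x ^+ 2 by rewrite mulr_ge0// exprn_ge0// ltW.
  have Ht : 0 <= H * t ^+ 2 by rewrite mulr_ge0// exprn_ge0// ltW.
  have [xt|/ltW tx] := leP x t.
    have [+ _] := gincr x t x0 xt ts; rewrite /g; lra.
  have [_] := gincr t x t0 tx xs; rewrite /g; lra.
(* By monotonicity this supremum is the limit of [g (-1)] at 0, hence that of [eta]; [gle] puts it
   between [g (-1) x] and [g 1 x] for every [x]. *)
pose b := sup [set g (-1) x | x in [set x | 0 < x <= s]].
have bx x : 0 < x <= s -> `|eta x - b| <= H * x ^+ 2.
  move=> x0s.
  have b1 : b <= g 1 x.
    apply: ge_sup; first by exists (g (-1) s), s => //=; rewrite s0/=.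
    by move=> _ [t /= t0s <-]; exact: gle.
  have b2 : g (-1) x <= b.
    apply: ub_le_sup; last by exists x.
    by exists (g 1 x) => _ [t /= t0s <-]; exact: gle.
  by move: b1 b2; rewrite ler_norml /g; lra.
exists b => x x0s; have /andP[x0 xs] := x0s.
have x20 : 0 < x ^+ 2 by rewrite exprn_gt0.
have yeta : y x - b * x ^+ 2 = x ^+ 2 * (eta x - b).
  by rewrite /eta; field; rewrite gt_eqF.
split.
  rewrite yeta normrM gtr0_norm// (exprD _ 2 2) mulrCA ler_pM2l//.
  exact: bx.
have -> : y' x - 2 * b * x = 2 * x * (eta x - b) + x ^+ 2 * eta' x.
  by rewrite /eta /eta'; field; rewrite gt_eqF.
apply: le_trans (ler_normD _ _) _.
rewrite (normrM (2 * x)) (normrM (x ^+ 2)) (gtr0_norm x20).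
rewrite (@gtr0_norm _ (2 * x)) ?mulr_gt0//.
have : 0 <= x * (H * x ^+ 2 - `|eta x - b|) by rewrite mulr_ge0 ?(ltW x0)// subr_ge0 bx.
have : 0 <= x ^+ 2 * (H * x - `|eta' x|) by rewrite mulr_ge0 ?(ltW x20)// subr_ge0 eta'H.
by lra.
Qed.

(** * From explicit bounds to asymptotic statements at 0 *)

Lemma eqaddO_at_right (R : realType) (s K : R) (f g e : R -> R) : 0 < s ->
  (forall x, 0 < x <= s -> `|f x - g x| <= K * `|e x|) ->
  f = g +O_ (0^'+) e.
Proof.
move=> s0 fg; apply/eqaddOP; near=> k; near=> x.
have x0s : 0 < x <= s.
  by apply/andP; split; near: x; [exact: nbhs_right_gt|exact: nbhs_right_le].
apply: le_trans (fg x x0s) _; apply: ler_wpM2r; first exact: normr_ge0.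
by near: k; apply: nbhs_pinfty_ge; exact: num_real.
Unshelve. all: by end_near. Qed.

Lemma cvg0_at_right (R : realType) (s C : R) (f : R -> R) : 0 < s ->
  (forall x, 0 < x <= s -> `|f x| <= C * x) -> f x @[x --> 0^'+] --> 0.
Proof.
move=> s0 fC; apply/cvgr0Pnorm_le => e e0; near=> x.
have x0s : 0 < x <= s.
  by apply/andP; split; near: x; [exact: nbhs_right_gt|exact: nbhs_right_le].
have /andP[x0 _] := x0s.
apply: le_trans (fC x x0s) _; apply: (@le_trans _ _ ((`|C| + 1) * x)).
  by rewrite ler_pM2r// (le_trans (ler_norm _))// lerDl.
have C1 : 0 < `|C| + 1 by rewrite ltr_wpDl.
rewrite mulrC -ler_pdivlMr//.
by near: x; apply: nbhs_right_le; rewrite divr_gt0.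
Unshelve. all: by end_near. Qed.

(** * Application to the system *)

Theorem theorem6p1 (R : realType) (eps lambda : R) (gamma phi : R -> R)
    (eps_gt0 : 0 < eps) (lambda_ge0 : 0 <= lambda)
    (gamma_bounded : [bounded gamma r | r in `]0, 1[%classic])
    (phi_bounded : [bounded phi r | r in `]0, 1[%classic])
    (finite_action : (action eps lambda gamma phi < +oo)%E)
    (solution : solves_system eps lambda gamma phi) :
  (exists a1 b2 : R,
    [/\ phi = (fun r : R => a1 * r) +O_ (0^'+) (fun r : R => r ^+ 3),
        gamma = (fun r : R => b2 * r ^+ 2) +O_ (0^'+) (fun r : R => r ^+ 4) &
        gamma^`() = (fun r : R => 2 * b2 * r)
                    +O_ (0^'+) (fun r : R => r ^+ 3)]) /\
  phi r @[r --> 0^'+] --> (0 : R) /\ gamma^`() r @[r --> 0^'+] --> (0 : R).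
Proof.
have [equations [_ gamma0 _]] := solution.
have [M M0 phiM] : exists2 M, 0 <= M & forall x, 0 < x < 1 -> `|phi x| <= M.
  have [M M0 phiM] := ex_strict_bound_gt0 phi_bounded.
  exists M; first exact: ltW.
  by move=> x x01; apply/ltW/phiM; rewrite /= in_itv.
(* The threshold 1/8 yields [p >= 1 / 2] below, and the bounds 2, 5/4 and 4 on [|1 + 2 * gamma|],
   [|1 + gamma|] and [|3 + 2 * gamma|]. *)
have [s1 s10 gamma_small] : exists2 s, 0 < s & forall x, 0 < x < s -> `|gamma x| < 1 / 8.
  have e8 : (0 : R) < 1 / 8 by lra.
  have [e /= e0 He] := cvgr0_norm_lt _ gamma0 _ e8.
  exists e => // x /andP[x0 xe]; apply: He => //=.
  by rewrite sub0r normrN gtr0_norm.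
pose s := Num.min (s1 / 2) (1 / 2).
have s0 : 0 < s by rewrite lt_min; apply/andP; split; lra.
have ss1 : s < s1 by rewrite gt_min; apply/orP; left; lra.
have s12 : s <= 1 / 2 by rewrite ge_min lexx orbT.
have s01 : 0 < s <= 1 by rewrite s0; lra.
(* The factor [x] removes the first-order term, as [(x * phi)'' = x * phi'' + 2 * phi']. The factors
   1 are those produced by the product rule. *)
pose Phi x := x * phi x.
pose Phi' x := 1 * phi x + x * phi^`() x.
pose Phi'' x := 1 * phi^`() x + (1 * phi^`() x + x * phi^`(2) x).
have x01 x : 0 < x <= s -> 0 < x < 1 by move=> /andP[-> xs]/=; lra.
have gamma8 x : 0 < x <= s -> `|gamma x| <= 1 / 8.
  by move=> /andP[x0 xs]; apply/ltW/gamma_small; rewrite x0 (le_lt_trans xs).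
have isd (g : R -> R) x : derivable g x 1 -> is_derive x 1 g (g^`() x).
  by move=> /derivableP; rewrite derive1E.
have dgamma : is_derive2 s gamma gamma^`() gamma^`(2).
  by move=> x /x01/equations[[? ?] _ _ _]; split; exact: isd.
have dPhi : is_derive2 s Phi Phi' Phi''.
  move=> x /x01/equations[_ [d1 d2] _ _]; have {}d1 := isd _ _ d1.
  have {}d2 := isd _ _ d2; split.
    by apply: is_derive1M => //; exact: is_derive_id.
  by apply: is_derive1D (is_derive1Ml 1 d1) (is_derive1M (is_derive_id x 1) d2).
pose p x := (1 + gamma x) * (1 + 2 * gamma x).
pose f x := 2 / eps * phi x ^+ 2 * (1 + 2 * gamma x).
have gammaE x : 0 < x <= s -> gamma^`(2) x = 2 * p x / x ^+ 2 * gamma x + f x.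
  move=> x0s; have [_ _ + _] := equations x (x01 x x0s).
  rewrite /gamma_equation => /eqP; rewrite -addrA -opprD subr_eq0 => /eqP ->.
  by rewrite /p /f; field; rewrite !gt_eqF//; case/andP: x0s.
(* The [lambda] term is also a multiple of [Phi]; moving it into the coefficient leaves a
   homogeneous equation. *)
pose q x := (1 + 2 * gamma x) ^+ 2 + lambda * x ^+ 2 * (phi x ^+ 2 - 1).
have PhiE x : 0 < x <= s -> Phi'' x = 2 * q x / x ^+ 2 * Phi x + 0.
  move=> x0s; have [_ _ _] := equations x (x01 x x0s).
  rewrite /phi_equation => e; have /andP[x0 _] := x0s.
  have : phi^`(2) x = - (2 * phi^`() x / x)
    + 2 * phi x / x ^+ 2 * (1 + 2 * gamma x) ^+ 2
    + 2 * lambda * phi x * (phi x ^+ 2 - 1) by lra.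
  by rewrite /Phi'' => ->; rewrite /Phi /q; field; rewrite gt_eqF.
have p_ge x : 0 < x <= s -> 1 - 3 * `|gamma x| <= p x.
  move=> x0s; rewrite /p; have := ler_norm (- gamma x); rewrite normrN.
  by have := sqr_ge0 (gamma x); lra.
(* Stated for any bound on [phi]: first the constant [M], later [C2 * x], which improves the source
   from bounded to [O(x ^+ 2)]. *)
have f_le C x : 0 < x <= s -> `|phi x| <= C ->
    `|f x| <= 4 / eps * C ^+ 2.
  move=> x0s phiC; rewrite /f normrM.
  have -> : 4 / eps * C ^+ 2 = (2 / eps * C ^+ 2) * 2 by field; rewrite gt_eqF.
  have eps0 : 0 <= 2 / eps by rewrite divr_ge0// ltW.
  rewrite ler_pM//.
    rewrite normrM normrX (ger0_norm eps0) ler_wpM2l// lerXn2r// nnegrE//.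
    exact: le_trans phiC.
  have := gamma8 x x0s; rewrite !ler_norml; lra.
(* Boundedness of [phi] is what excludes the exponent -1 for [Phi]. *)
have Phi0 : Phi x @[x --> 0^'+] --> 0.
  apply: (cvg0_at_right s0 (C := M)) => x x0s; have /andP[x0 _] := x0s.
  by rewrite /Phi normrM gtr0_norm// mulrC ler_pM2r// phiM// x01.
have [C1 C10 gammaC1] : exists2 C, 0 <= C & forall x, 0 < x <= s -> `|gamma x| <= C * x.
  apply: (linear_bound s01 dgamma (p := p) (f := f) (F := 4 / eps * M ^+ 2)) gamma0.
  move=> x x0s; split; first exact: gammaE.
    by have := p_ge x x0s; have := gamma8 x x0s; lra.
  by apply: f_le => //; exact: phiM (x01 x x0s).
(* [4 * C1] covers the linear defects of [p] and [q] due to [gamma], [lambda] covers the negative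
   part of the potential term, and 1 ensures [K >= 1]. *)
pose K := 4 * C1 + lambda + 1.
have K1 : 1 <= K by rewrite /K; lra.
pose t := Num.min s (1 / 2 / K).
have t0 : 0 < t by rewrite lt_min s0/= divr_gt0//; lra.
have ts : t <= s by rewrite ge_min lexx.
have t01 : 0 < t <= 1 by rewrite t0; lra.
have Kt : K * t <= 1 / 2.
  by rewrite mulrC -ler_pdivlMr ?ge_min ?lexx ?orbT//; lra.
have st x : 0 < x <= t -> 0 < x <= s by move=> /andP[-> xt]; exact: le_trans xt ts.
have dgammat : is_derive2 t gamma gamma^`() gamma^`(2) by move=> x /st/dgamma.
have dPhit : is_derive2 t Phi Phi' Phi'' by move=> x /st/dPhi.
have q_ge x : 0 < x <= t -> 1 - K * x <= q x.
  move=> x0t; have x0s := st x x0t; have /andP[x0 xs] := x0s.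
  have : - (4 * gamma x) <= 4 * (C1 * x).
    by have := gammaC1 x x0s; rewrite ler_norml; lra.
  have : 0 <= lambda * x * (1 - x) by rewrite !mulr_ge0 ?(ltW x0)//; lra.
  have : 0 <= lambda * (x * phi x) ^+ 2 by rewrite mulr_ge0// sqr_ge0.
  have := sqr_ge0 (gamma x).
  rewrite /q /K; lra.
have [C2 C20 PhiC2] : exists2 C, 0 <= C & forall x, 0 < x <= t -> `|Phi x| <= C * x ^+ 2.
  apply: (quadratic_bound t0 K1 Kt dPhit (p := q) (f := fun=> 0) (F := 0)) Phi0.
  move=> x x0t; split; [exact: PhiE (st x x0t)|exact: q_ge|].
  by rewrite normr0 mul0r.
have phiC2 x : 0 < x <= t -> `|phi x| <= C2 * x.
  move=> x0t; have /andP[x0 _] := x0t.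
  rewrite -(ler_pM2l x0) -{1}(gtr0_norm x0) -normrM (le_trans (PhiC2 x x0t))//.
  by rewrite expr2 mulrCA.
have [C3 C30 gammaC3] : exists2 C, 0 <= C & forall x, 0 < x <= t -> `|gamma x| <= C * x ^+ 2.
  apply: (quadratic_bound t0 K1 Kt dgammat (p := p) (f := f) (F := 4 / eps * C2 ^+ 2)) gamma0.
  move=> x x0t; have x0s := st x x0t; have /andP[x0 xt] := x0t; split; first exact: gammaE.
    have := p_ge x x0s; have := gammaC1 x x0s.
    have : 0 <= C1 * x by rewrite mulr_ge0// ltW.
    have : 0 <= lambda * x by rewrite mulr_ge0// ltW.
    by rewrite /K; lra.
  apply: le_trans (f_le _ x x0s (phiC2 x x0t)) _ => //.
  rewrite exprMn mulrA; apply: ler_wpM2l; first by rewrite mulr_ge0 ?sqr_ge0// divr_ge0// ltW.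
  by rewrite expr2 ler_piMr ?ltW//; lra.
(* As [p = 1 + 3 * gamma + 2 * gamma ^+ 2], replacing [p] by 1 leaves the remainder [2 * gamma ^+ 2
   * (3 + 2 * gamma) / x ^+ 2], at most [8 * C3 ^+ 2 * x ^+ 2]; the other summand bounds [f]. *)
have [b b_exp] : exists b, forall x, 0 < x <= t ->
    `|gamma x - b * x ^+ 2| <= (4 / eps * C2 ^+ 2 + 8 * C3 ^+ 2) * x ^+ 4 /\
    `|gamma^`() x - 2 * b * x| <= 3 * (4 / eps * C2 ^+ 2 + 8 * C3 ^+ 2) * x ^+ 3.
  apply: (quadratic_expansion (C := C3) t01 dgammat
    (h := fun x => f x + 2 / x ^+ 2 * gamma x ^+ 2 * (3 + 2 * gamma x))).
  move=> x x0t; have x0s := st x x0t; have /andP[x0 xt] := x0t; split.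
  - by rewrite gammaE// /p; field; rewrite gt_eqF.
  - rewrite [X in _ <= X]mulrDl; apply: le_trans (ler_normD _ _) _; apply: lerD.
      apply: le_trans (f_le _ x x0s (phiC2 x x0t)) _ => //.
      by rewrite exprMn mulrA.
    have x20 : 0 <= 2 / x ^+ 2 by rewrite divr_ge0// exprn_ge0// ltW.
    have -> : 8 * C3 ^+ 2 * x ^+ 2 = (2 / x ^+ 2 * (C3 * x ^+ 2) ^+ 2) * 4.
      by field; rewrite gt_eqF.
    rewrite normrM ler_pM//.
      rewrite normrM (ger0_norm x20) normrX ler_wpM2l// lerXn2r// ?nnegrE//.
        by rewrite mulr_ge0// exprn_ge0// ltW.
      exact: gammaC3.
    by have := gamma8 x x0s; rewrite !ler_norml; lra.
  - exact: gammaC3.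
(* The bracket bounds [|q - 1| / x ^+ 2]: [4 * gamma * (1 + gamma)] contributes [4 * C3 * (5 / 4)],
   and [|phi ^+ 2 - 1| <= M ^+ 2 + 1]. *)
pose H := 2 * (5 * C3 + lambda * (M ^+ 2 + 1)) * C2.
have [a a_exp] : exists a, forall x, 0 < x <= t ->
    `|Phi x - a * x ^+ 2| <= H * x ^+ 4 /\ `|Phi' x - 2 * a * x| <= 3 * H * x ^+ 3.
  apply: (quadratic_expansion (C := C2) t01 dPhit
    (h := fun x => 2 / x ^+ 2 * (q x - 1) * Phi x)).
  move=> x x0t; have x0s := st x x0t; have /andP[x0 xt] := x0t; split.
  - by rewrite PhiE//; field; rewrite gt_eqF.
  - have x20 : 0 <= 2 / x ^+ 2 by rewrite divr_ge0// exprn_ge0// ltW.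
    have -> : H * x ^+ 2 =
        2 / x ^+ 2 * ((5 * C3 + lambda * (M ^+ 2 + 1)) * x ^+ 2) * (C2 * x ^+ 2).
      by rewrite /H; field; rewrite gt_eqF.
    rewrite normrM ler_pM//; last exact: PhiC2.
    rewrite normrM (ger0_norm x20) ler_wpM2l//.
    have -> : q x - 1 = 4 * gamma x * (1 + gamma x) + lambda * x ^+ 2 * (phi x ^+ 2 - 1).
      by rewrite /q; ring.
    apply: le_trans (ler_normD _ _) _; rewrite [X in _ <= X]mulrDl lerD//.
      have -> : 5 * C3 * x ^+ 2 = 4 * (C3 * x ^+ 2) * (5 / 4) by field.
      rewrite normrM ler_pM//.
        by rewrite normrM ger0_norm// ler_pM2l// gammaC3.
      by have := gamma8 x x0s; rewrite !ler_norml; lra.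
    have lx : 0 <= lambda * x ^+ 2 by rewrite mulr_ge0// exprn_ge0// ltW.
    rewrite normrM (ger0_norm lx) [X in _ <= X]mulrAC ler_wpM2l//.
    have : phi x ^+ 2 <= M ^+ 2.
      by rewrite -real_normK ?num_real// lerXn2r ?nnegrE// phiM// x01.
    by have := sqr_ge0 (phi x); rewrite ler_norml; have := sqr_ge0 M; lra.
  - exact: PhiC2.
have phi_exp x : 0 < x <= t -> `|phi x - a * x| <= H * x ^+ 3.
  move=> x0t; have /andP[x0 _] := x0t; rewrite -(ler_pM2l x0).
  have -> : x * (H * x ^+ 3) = H * x ^+ 4 by ring.
  rewrite -{1}(gtr0_norm x0) -normrM.
  have -> : x * (phi x - a * x) = Phi x - a * x ^+ 2 by rewrite /Phi; ring.
  by have [] := a_exp x x0t.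
split.
  exists a, b; split.
  - apply: (eqaddO_at_right t0 (K := H)) => x x0t; have /andP[x0 _] := x0t.
    by rewrite (@gtr0_norm _ (x ^+ 3)) ?exprn_gt0//; exact: phi_exp.
  - apply: (eqaddO_at_right t0) => x x0t; have /andP[x0 _] := x0t.
    by rewrite (@gtr0_norm _ (x ^+ 4)) ?exprn_gt0//; have [+ _] := b_exp x x0t; exact.
  - apply: (eqaddO_at_right t0) => x x0t; have /andP[x0 _] := x0t.
    by rewrite (@gtr0_norm _ (x ^+ 3)) ?exprn_gt0//; have [_ +] := b_exp x x0t; exact.
split; first exact: cvg0_at_right phiC2.
set H' := 4 / eps * C2 ^+ 2 + _ in b_exp.
(* On [(0, t]] one has [x ^+ 3 <= x], so the remainder in the expansion of [gamma'] is itself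
   bounded linearly. *)
apply: (cvg0_at_right t0 (C := 2 * `|b| + 3 * H')) => x x0t.
have /andP[x0 xt] := x0t; have [_ b'] := b_exp x x0t.
have -> : gamma^`() x = (gamma^`() x - 2 * b * x) + 2 * b * x by ring.
apply: le_trans (ler_normD _ _) _.
rewrite [X in _ <= X]mulrDl [X in _ <= X]addrC lerD//.
  apply: le_trans b' _; rewrite ler_wpM2l//.
    by rewrite mulr_ge0// addr_ge0// mulr_ge0 ?sqr_ge0// divr_ge0// ltW.
  by rewrite exprS ler_piMr ?(ltW x0)// exprn_ile1 ?(ltW x0)//; lra.
by rewrite !normrM (gtr0_norm x0) ger0_norm.
Qed.
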